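(* Let $b \geq 3$ be an integer. Then the equation $$\frac{(1 + s)\zeta_b'(s)}{1 + \zeta_b(s)} - \log\left(\frac{1 + \zeta_b(s)}{b}\right) = 0$$ has a unique solution $s = s_{b,0}$ over the positive real numbers. Moreover, setting $$\eta_{b,0} := 1 + \frac{1}{(1 + s_{b,0})\log b}\log\left(\frac{1 + \zeta_b(s_{b,0})}{b}\right),$$ we have $0 < \eta_{b,0} < 1$ and $$\#\mathcal{N}_{b,0}(x) < x^{\eta_{b,0} + o(1)}, \quad \text{as } x \to +\infty.$$
   Context: For an integer $b \geq 2$, every positive integer $n$ has a unique representation $n = \sum_{j=0}^{\ell} d_j b^j$ with $d_0,\dots,d_\ell \in \{0,\dots,b-1\}$ and $d_\ell \neq 0$; the $d_0,\dots,d_\ell$ are the base $b$ digits of $n$. Let $p_{b,0}(n)$ be the product of the nonzero base $b$ digits of $n$. For real $x \geq 1$, let $\mathcal{N}_{b,0}(x) := \{n \leq x : p_{b,0}(n) \mid n\}$, where $n$ ranges over positive integers. For real $s \geq 0$, let $\zeta_b(s) := \sum_{d=1}^{b-1} d^{-s}$, and let $\zeta_b'$ be its derivative with respect to $s$. $\log$ is the natural logarithm. The notation $f(x) < x^{\eta + o(1)}$ as $x \to +\infty$ (with $b$ fixed) means that there is a function $\varepsilon(x)$ with $\varepsilon(x) \to 0$ as $x \to +\infty$ such that $f(x) < x^{\eta + \varepsilon(x)}$ for all sufficiently large $x$. *)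

(* Defs.v *)
From HB Require Import structures.
From mathcomp Require Import all_boot all_order all_algebra.
From mathcomp Require Import finmap.
From mathcomp Require Import all_classical all_reals all_analysis.
Set Implicit Arguments.
Unset Strict Implicit.
Unset Printing Implicit Defensive.

Import Order.TTheory GRing.Theory Num.Theory.
Import numFieldNormedType.Exports.
Local Open Scope classical_set_scope.
Local Open Scope ring_scope.

(* Least significant digit first; meaningful for [1 < b] and [0 < n], see
   [digitsP]. *)
Definition digits (b n : nat) : seq nat :=
  [seq (n %/ b ^ j %% b)%N | j <- iota 0 (trunc_log b n).+1].

Lemma digits_sum (b n k : nat) : (0 < b)%N ->
  (\sum_(j < k) (n %/ b ^ j %% b) * b ^ j)%N = (n %% b ^ k)%N.
Proof.
move=> b0; elim: k => [|k IH]; first by rewrite big_ord0 expn0 modn1.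
rewrite big_ord_recr /= IH.
have bk : (0 < b ^ k)%N by rewrite expn_gt0 b0.
set q := (n %/ b ^ k)%N.
have -> : n = ((q %/ b) * b ^ k.+1 + ((q %% b) * b ^ k + n %% b ^ k))%N.
  rewrite {1}(divn_eq n (b ^ k)) -/q {1}(divn_eq q b) mulnDl addnA.
  by rewrite expnS mulnA.
rewrite modnMDl [RHS]modn_small.
  rewrite addnC; congr (_ + _)%N.
  by rewrite expnS mulnA modnMDl modnMDl modn_mod.
have qb : (q %% b < b)%N by rewrite ltn_mod.
apply: (@leq_trans ((q %% b).+1 * b ^ k)).
  by rewrite mulSn addnC ltn_add2r ltn_mod.
by rewrite expnS leq_mul2r qb orbT.
Qed.

Lemma digits_inj (b : nat) (s t : seq nat) : (1 < b)%N ->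
  all (fun d => d < b)%N s -> all (fun d => d < b)%N t ->
  last 1%N s != 0%N -> last 1%N t != 0%N ->
  (\sum_(j < size s) nth 0 s j * b ^ j)%N =
    (\sum_(j < size t) nth 0 t j * b ^ j)%N -> s = t.
Proof.
move=> b1; have b0 : (0 < b)%N by apply: ltnW.
have sumE (u : seq nat) d :
    (\sum_(j < size (d :: u)) nth 0 (d :: u) j * b ^ j =
     d + b * \sum_(j < size u) nth 0 u j * b ^ j)%N.
  rewrite /= big_ord_recl /= expn0 muln1; congr (_ + _)%N.
  rewrite big_distrr /=; apply: eq_bigr => i _.
  by rewrite /bump /= add1n expnS mulnCA.
have pos (u : seq nat) d : last 1%N (d :: u) != 0%N ->
    (0 < \sum_(j < size (d :: u)) nth 0 (d :: u) j * b ^ j)%N.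
  move=> h; rewrite /= big_ord_recr /= addn_gt0; apply/orP; right.
  by rewrite muln_gt0 expn_gt0 b0 andbT -[X in nth _ _ X]/((size (d :: u)).-1)
    nth_last lt0n.
have lw (u : seq nat) d : last 1%N (d :: u) != 0%N -> last 1%N u != 0%N.
  by case: u.
elim: s t => [|d s IH] [|e t] //.
- by move=> _ _ _ h; rewrite [LHS]big_ord0 => /esym E; have := pos _ _ h; rewrite E.
- by move=> _ _ h _; rewrite [RHS]big_ord0 => E; have := pos _ _ h; rewrite E.
move=> /andP[db sb] /andP[eb tb] ls lt; rewrite !sumE => E.
have de : d = e.
  by have := congr1 (modn^~ b) E; rewrite /= !(addnC _ (b * _)%N) !(mulnC b)
    !modnMDl !modn_small.
rewrite de; congr (_ :: _); apply: IH => //; [exact: lw ls|exact: lw lt|].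
by move: E; rewrite de => /addnI /eqP; rewrite eqn_pmul2l // => /eqP.
Qed.

Lemma digitsP (b n : nat) (s : seq nat) : (1 < b)%N -> (0 < n)%N ->
  [/\ all (fun d => d < b)%N s, last 0%N s != 0%N &
      n = (\sum_(j < size s) nth 0 s j * b ^ j)%N] <-> s = digits b n.
Proof.
move=> b1 n0; have b0 : (0 < b)%N by apply: ltnW.
have /andP[lo hi] := trunc_log_bounds b1 n0.
have D1 : all (fun d => d < b)%N (digits b n).
  by apply/allP => d /mapP[j _ ->]; rewrite ltn_mod.
have D2 c : last c (digits b n) != 0%N.
  rewrite /digits -addn1 iotaD map_cat last_cat /= modn_small.
    by rewrite -lt0n divn_gt0 // expn_gt0 b0.
  by rewrite ltn_divLR ?expn_gt0 ?b0 // -expnS.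
have D3 : n = (\sum_(j < size (digits b n)) nth 0 (digits b n) j * b ^ j)%N.
  rewrite -[LHS](modn_small hi) -digits_sum // /digits size_map size_iota.
  apply: eq_bigr => j _.
  by rewrite (nth_map 0%N) ?size_iota // nth_iota // add0n.
split=> [[s1 s2 s3]|->]; last by split.
apply: (digits_inj b1) => //; last by rewrite -s3 -D3.
by case: s s2 {s1 s3}.
Qed.

Definition nzdigit_prod (b n : nat) : nat :=
  (\prod_(d <- digits b n | d != 0) d)%N.

Definition Nb0 (R : realType) (b : nat) (x : R) : set nat :=
  [set n | [/\ (0 < n)%N, n%:R <= x & (nzdigit_prod b n %| n)%N]].

(* [fset_set] is the junk value [fset0] on infinite sets. *)
Lemma finite_Nb0 (R : realType) (b : nat) (x : R) : finite_set (Nb0 b x).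
Proof.
apply: (@sub_finite_set _ _ `I_(Num.truncn x).+1) => [n [_ nx _] /=|].
  rewrite ltnS -[n](natrK (R := R)); exact: le_truncn.
exact: finite_II.
Qed.

Definition card_Nb0 (R : realType) (b : nat) (x : R) : nat :=
  #|` fset_set (Nb0 b x)|.

Definition zetab (R : realType) (b : nat) (s : R) : R :=
  \sum_(1 <= d < b) d%:R `^ (- s).

Definition saddle_eq (R : realType) (b : nat) (s : R) : Prop :=
  (1 + s) * derive1 (@zetab R b) s / (1 + zetab b s)
    - ln ((1 + zetab b s) / b%:R) = 0.

Definition eta0 (R : realType) (b : nat) (s : R) : R :=
  1 + 1 / ((1 + s) * ln b%:R) * ln ((1 + zetab b s) / b%:R).

(* [f x < x ^ (eta + o(1))] as [x --> +oo]. *)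
Definition lt_powR_o1 (R : realType) (f : R -> R) (eta : R) : Prop :=
  exists eps : R -> R,
    eps x @[x --> +oo%R] --> 0 /\
    \forall x \near +oo%R, f x < x `^ (eta + eps x).

(* Main.v *)
(* Write Z(s) = 1 + zeta_b(s) and L = ln Z. Up to the factor (1 + s)^2, the
   left-hand side of the equation is the derivative of (L(s) - ln b) / (1 + s).
   It is strictly increasing because L is strictly convex, negative at 0, and
   tends to ln (b / 2) > 0 because Z tends to 2.
   For the counting bound, the n < b^N fall into at most (N + 1)^b classes
   according to how often each digit occurs. In a class with digit product m,
   at most b^N / m elements are multiples of m, and by Rankin's trick the class
   has at most m^s Z(s)^N elements. A geometric mean of the two bounds
   eliminates m and leaves (b^s Z(s))^(N / (1 + s)) = b^(N eta). *)
Require Import Defs.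
From HB Require Import structures.
From mathcomp Require Import all_boot all_order all_algebra.
From mathcomp Require Import finmap.
From mathcomp Require Import all_classical all_reals all_analysis.
From mathcomp Require Import ring lra zify.
Import Order.TTheory GRing.Theory Num.Theory.
Import numFieldNormedType.Exports.
Local Open Scope classical_set_scope.
Local Open Scope ring_scope.

(** * Strict log-convexity of finite exponential sums *)

Section ExponentialSum.
Context {R : realType} {n : nat}.
Implicit Types (l : 'I_n -> R) (s t : R).

Definition expsum l s : R := \sum_(i < n) expR (- (l i * s)).
Definition dexpsum l s : R := \sum_(i < n) - l i * expR (- (l i * s)).
Definition lexpsum l s : R := ln (expsum l s).
Definition dlexpsum l s : R := dexpsum l s / expsum l s.

Lemma is_derive_expsum l s : is_derive s 1 (expsum l) (dexpsum l s).
Proof.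
rewrite (_ : expsum l = \sum_(i < n) (fun s => expR (- (l i * s)))); last first.
  by apply/funext => t; rewrite fct_sumE.
rewrite /dexpsum; apply: is_derive_sum => i.
have : is_derive s 1 (fun s => - (l i * s)) (- l i).
  have := is_deriveN (is_deriveZ (l i) (is_derive_id s (1 : R))).
  by rewrite [X in is_derive _ _ _ (- X)]mulr1; apply.
move=> h; have := @is_derive1_comp _ expR (fun s => - (l i * s)) s _ _
  (is_derive_expR _) h.
by rewrite [X in is_derive _ _ _ X]mulrC.
Qed.

Lemma continuous_expR_lin (a : R) : continuous (fun s => expR (- (a * s))).
Proof.
move=> s; apply: continuous_comp; last exact: continuous_expR.
apply: cvgN; apply: cvgM; [exact: cvg_cst|exact: cvg_id].
Qed.

Lemma continuous_expsum l : continuous (expsum l).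
Proof.
move=> s; rewrite /expsum; apply: cvg_big => [|i _].
  exact: (@add_continuous R^o).
exact: continuous_expR_lin.
Qed.

Lemma continuous_dexpsum l : continuous (dexpsum l).
Proof.
move=> s; rewrite /dexpsum; apply: cvg_big => [|i _].
  exact: (@add_continuous R^o).
apply: cvgM.
  exact: cvg_cst.
exact: continuous_expR_lin.
Qed.

Lemma expsum_gt0 l s : (0 < n)%N -> 0 < expsum l s.
Proof.
move=> n0; rewrite /expsum (bigD1 (Ordinal n0)) //=.
by rewrite ltr_wpDr ?expR_gt0 // sumr_ge0 // => i _; exact: expR_ge0.
Qed.

Lemma continuous_lexpsum l : (0 < n)%N -> continuous (lexpsum l).
Proof.
move=> n0 s; apply: continuous_comp; first exact: continuous_expsum.
exact/continuous_ln/expsum_gt0.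
Qed.

Lemma continuous_dlexpsum l : (0 < n)%N -> continuous (dlexpsum l).
Proof.
move=> n0 s; apply: cvgM; first exact: continuous_dexpsum.
apply: cvgV; first by rewrite gt_eqF // expsum_gt0.
exact: continuous_expsum.
Qed.

(* Jensen's inequality, obtained by summing [1 + x <= expR x] at the
   deviations from the weighted mean. *)
Lemma lexpsum_gt_tangent l s t (i j : 'I_n) : l i != l j -> s != t ->
  lexpsum l t + dlexpsum l t * (s - t) < lexpsum l s.
Proof.
move=> lij st.
have n0 : (0 < n)%N by exact: leq_ltn_trans (leq0n i) (ltn_ord i).
have Zt := expsum_gt0 l t n0; have Zs := expsum_gt0 l s n0.
set m := dlexpsum l t * (s - t).
suff h : expsum l t * expR m < expsum l s.
  rewrite -ltr_expR expRD !lnK // posrE //.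
pose x k := - (l k * (s - t)) - m.
have E k : expR (- (l k * s)) = expR m * (expR (- (l k * t)) * expR (x k)).
  by rewrite -!expRD /x; congr expR; ring.
have mean : \sum_(k < n) expR (- (l k * t)) * x k = 0.
  have -> : \sum_(k < n) expR (- (l k * t)) * x k =
    dexpsum l t * (s - t) - expsum l t * m.
    rewrite /dexpsum /expsum !mulr_suml -sumrB; apply: eq_bigr => k _.
    by rewrite /x; ring.
  by rewrite /m /dlexpsum; field; rewrite gt_eqF.
rewrite {2}/expsum (eq_bigr _ (fun k _ => E k)) -mulr_sumr mulrC.
rewrite ltr_pM2l ?expR_gt0 // -[ltLHS]addr0 -[X in _ + X < _]mean -big_split /=.
(* The terms with [l i] and [l j] cannot both sit at the weighted mean, so one inequality is
   strict. *)
have [k xk] : exists k, x k != 0.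
  apply/existsP; rewrite -[X in is_true X]negbK negb_exists.
  apply/negP => /forallP h.
  have := h i; have := h j; rewrite !negbK /x => /eqP hj /eqP hi.
  move/eqP: lij; apply; apply: (mulIf (x := s - t)); first by rewrite subr_eq0.
  by move: hi hj; lra.
rewrite (bigD1 k) //= [X in _ < X](bigD1 k) //=.
have F c : expR (- (l c * t)) + expR (- (l c * t)) * x c =
    expR (- (l c * t)) * (1 + x c) by ring.
apply: ltr_leD.
  by rewrite F ltr_pM2l ?expR_gt0 // expR_gt1Dx.
by apply: ler_sum => c _; rewrite F ler_pM2l ?expR_gt0 // expR_ge1Dx.
Qed.

(* [(1 + s) ^+ 2] times the derivative of
   [(lexpsum l s - c) / (1 + s)]. *)
Definition saddle l (c s : R) : R :=
  (1 + s) * dlexpsum l s - (lexpsum l s - c).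

Lemma continuous_saddle l c : (0 < n)%N -> continuous (saddle l c).
Proof.
move=> n0 s; apply: cvgB; last first.
  by apply: cvgB; [exact: continuous_lexpsum|exact: cvg_cst].
apply: cvgM; last exact: continuous_dlexpsum.
by apply: cvgD; [exact: cvg_cst|exact: cvg_id].
Qed.

(** The tangent at [t] bounds the difference below by [1 + s] times the increment of [dlexpsum], and
    the two tangents together make that increment positive. *)
Lemma saddle_lt l c (i j : 'I_n) s t : l i != l j -> -1 < s -> s < t ->
  saddle l c s < saddle l c t.
Proof.
move=> lij s1 st.
have h1 : lexpsum l t + dlexpsum l t * (s - t) < lexpsum l s.
  by apply: lexpsum_gt_tangent lij _; rewrite lt_eqF.
have h2 : lexpsum l s + dlexpsum l s * (t - s) < lexpsum l t.
  by apply: lexpsum_gt_tangent lij _; rewrite gt_eqF.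
rewrite /saddle; nra.
Qed.

(* The tangent at [s], evaluated at [s / 2], controls the derivative. *)
Lemma saddle_gt l c (i j : 'I_n) s : l i != l j -> 1 <= s ->
  lexpsum l s <= lexpsum l (s / 2) ->
  c + 3 * lexpsum l s - 4 * lexpsum l (s / 2) < saddle l c s.
Proof.
move=> lij s1 le2.
have h : lexpsum l s + dlexpsum l s * (s / 2 - s) < lexpsum l (s / 2).
  by apply: lexpsum_gt_tangent lij _; rewrite lt_eqF //; lra.
(* The factor 4 bounds [2 * (1 + s) / s], which multiplies the nonpositive
   [lexpsum l s - lexpsum l (s / 2)]. *)
rewrite /saddle; nra.
Qed.

End ExponentialSum.

(** * Digit weights, the saddle point and the range of the exponent *)

Section DigitWeights.
Context {R : realType} {b : nat}.

(** The [maxn] lets digit 0 weigh as much as digit 1; it supplies the summand 1 in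
    [1 + zetab b s]. *)
Definition logdigit (d : 'I_b) : R := ln (maxn 1 d)%:R.

Lemma expR_logdigit (d : 'I_b) s :
  expR (- (logdigit d * s)) = (maxn 1 d)%:R `^ (- s) :> R.
Proof. by rewrite -mulrN expRM lnK // posrE ltr0n leq_max. Qed.

Lemma logdigit_ge0 d : 0 <= logdigit d.
Proof. by rewrite ln_ge0 // ler1n leq_max. Qed.

Lemma expsum_logdigit s : (0 < b)%N -> expsum logdigit s = 1 + zetab b s.
Proof.
move=> b0; rewrite /expsum /zetab.
under eq_bigr do rewrite expR_logdigit.
rewrite -(big_mkord predT (fun d => (maxn 1 d)%:R `^ (- s) : R)) big_ltn //.
by rewrite powR1; congr (_ + _); apply: eq_big_nat => d /andP[/maxn_idPr -> _].
Qed.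

Lemma derive1_zetab s : (0 < b)%N ->
  derive1 (@zetab R b) s = dexpsum logdigit s.
Proof.
move=> b0; have -> : zetab b = (fun s => expsum logdigit s + (-1)).
  by apply/funext => t; rewrite expsum_logdigit // addrC addKr.
rewrite derive1E; apply: derive_val.
have := is_deriveD (is_derive_expsum logdigit s) (is_derive_cst (-1 : R) s 1).
by rewrite addr0.
Qed.

Lemma saddle_eqE s : (0 < b)%N ->
  saddle_eq b s <-> saddle logdigit (ln b%:R) s = 0.
Proof.
move=> b0; rewrite /saddle_eq derive1_zetab // -expsum_logdigit //.
by rewrite ln_div ?posrE ?ltr0n ?expsum_gt0 // /saddle /lexpsum mulrA.
Qed.

Context (b3 : (3 <= b)%N).
Let b0 : (0 < b)%N := leq_trans (isT : 0 < 3)%N b3.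
Let o0 : 'I_b := Ordinal b0.
Let o1 : 'I_b := Ordinal (leq_trans (isT : 1 < 3)%N b3).
Let o2 : 'I_b := Ordinal b3.

(** Provides the two distinct weights that strict convexity requires. *)
Lemma logdigit_neq : logdigit o0 != logdigit o2.
Proof. by rewrite /logdigit /= ln1 lt_eqF // ln_gt0 // ltr1n. Qed.

Lemma expsum_logdigit0 : expsum logdigit 0 = b%:R.
Proof.
rewrite /expsum; under eq_bigr do rewrite mulr0 oppr0 expR0.
by rewrite sumr_const card_ord.
Qed.

Lemma expsum_logdigit_gt2 s : 2 < expsum logdigit s.
Proof.
rewrite /expsum (bigD1 o0) //= (bigD1 o1) //= (bigD1 o2) //=.
rewrite /logdigit /= maxnn ln1 !mul0r oppr0 expR0.
rewrite addrA ltrDl ltr_pwDl ?expR_gt0 // sumr_ge0 // => i _; exact: expR_ge0.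
Qed.

Lemma expsum_logdigit_nincr s t : s <= t ->
  expsum logdigit t <= expsum logdigit s.
Proof.
move=> st; apply: ler_sum => d _; rewrite ler_expR lerN2.
by rewrite ler_wpM2l // logdigit_ge0.
Qed.

Lemma expsum_logdigit_ltb s : 0 < s -> expsum logdigit s < b%:R.
Proof.
move=> s0; rewrite -expsum_logdigit0 /expsum (bigD1 o2) //=.
rewrite [ltRHS](bigD1 o2) //=; apply: ltr_leD.
  by rewrite ltr_expR ltrN2 ltr_pM2l // ln_gt0 // ltr1n.
apply: ler_sum => d _; rewrite ler_expR lerN2.
by rewrite ler_wpM2l ?logdigit_ge0 // ltW.
Qed.

(** Makes the limit 2 explicit: digits 0 and 1 contribute 1 each, and every other weight is at least
    [ln 2]. *)
Lemma expsum_logdigit_le s : 0 <= s ->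
  expsum logdigit s <= 2 + b%:R * expR (- (ln 2 * s)).
Proof.
move=> s0; rewrite /expsum (bigD1 o0) //= (bigD1 o1) //=.
rewrite /logdigit /= maxnn ln1 !mul0r oppr0 expR0 addrA lerD2l.
apply: (@le_trans _ _ (\sum_(d < b) expR (- (ln 2 * s)))).
  rewrite [leRHS](bigID (fun d => (d != o0) && (d != o1))) /=.
  apply: ler_wpDr; first by apply: sumr_ge0 => *; exact: expR_ge0.
  apply: ler_sum => d /andP[d0 d1]; rewrite ler_expR lerN2 ler_wpM2r //.
  rewrite ler_ln ?posrE ?ltr0n ?leq_max // ler_nat leq_max; apply/orP; right.
  by move: d0 d1; rewrite -!val_eqE /=; case: d => [[|[]]].
by rewrite sumr_const card_ord mulr_natl.
Qed.

(** At 0 the two logarithms cancel, and what remains is minus the mean weight, negative because of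
    digit 2. *)
Lemma saddle_logdigit0 : saddle logdigit (ln b%:R) 0 < 0.
Proof.
rewrite /saddle /lexpsum expsum_logdigit0 subrr subr0 addr0 mul1r /dlexpsum.
rewrite pmulr_llt0 ?invr_gt0 ?expsum_gt0 //.
rewrite /dexpsum; under eq_bigr do rewrite mulr0 oppr0 expR0 mulr1.
rewrite sumrN oppr_lt0 (bigD1 o2) //= ltr_pwDl // ?ln_gt0 ?ltr1n //.
by apply: sumr_ge0 => d _; exact: logdigit_ge0.
Qed.

Lemma saddle_logdigit_pos : exists2 s, 0 < s & 0 < saddle logdigit (ln b%:R) s.
Proof.
have bR : 3 <= b%:R :> R by rewrite ler_nat.
have l2 : 0 < ln 2 :> R by rewrite ln_gt0 // ltr1n.
(* With this [e], the bounds [L2] and [Ls] make the lower bound of [saddle_gt] positive. *)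
pose e : R := (ln b%:R - ln 2) / 4.
have e0 : 0 < e by rewrite divr_gt0 // subr_gt0 ltr_ln ?posrE ?ltr0n //; lra.
(* At [s / 2] the terms with [2 <= d] total at most [2 * e]. *)
pose u := (Num.max 0 (ln (b%:R / (2 * e)))) / ln 2.
pose s : R := 2 * u + 1.
have u0 : 0 <= u by rewrite divr_ge0 ?(ltW l2) // le_max lexx.
have s1 : 1 <= s by rewrite /s; lra.
exists s; first by lra.
have Zs : expsum logdigit (s / 2) <= 2 * (1 + e).
  apply: le_trans (expsum_logdigit_le _ _) _; first by lra.
  suff : expR (- (ln 2 * (s / 2))) <= 2 * e / b%:R.
    by rewrite ler_pdivlMr; [lra|lra].
  rewrite -[leRHS]invf_div expRN lef_pV2 ?posrE ?expR_gt0 //; last first.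
    by rewrite divr_gt0 //; lra.
  rewrite -[leLHS]lnK ?posrE ?divr_gt0 //; try lra.
  rewrite ler_expR; apply: (@le_trans _ _ (ln 2 * u)).
    by rewrite /u [ln 2 * _]mulrC divfK ?gt_eqF // le_max lexx orbT.
  by rewrite ler_pM2l // /s; lra.
have Ls : lexpsum logdigit (s / 2) < ln 2 + e.
  have -> : ln 2 + e = ln (2 * expR e) by rewrite lnM ?posrE ?expR_gt0 ?expRK.
  rewrite ltr_ln ?posrE ?expsum_gt0 ?mulr_gt0 ?expR_gt0 //.
  apply: le_lt_trans Zs _; rewrite ltr_pM2l // expR_gt1Dx //; exact: lt0r_neq0.
have L2 : ln 2 < lexpsum logdigit s.
  rewrite ltr_ln ?posrE ?expsum_gt0 //; exact: expsum_logdigit_gt2.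
apply: lt_trans _ (saddle_gt _ _ _ _ _ logdigit_neq s1 _).
  by rewrite /e in Ls *; lra.
rewrite ler_ln ?posrE ?expsum_gt0 //; apply: expsum_logdigit_nincr; lra.
Qed.

Lemma exists_unique_saddle : exists! s : R, 0 < s /\ saddle_eq b s.
Proof.
have [t t0 gt] := saddle_logdigit_pos; have g0 := saddle_logdigit0.
have [||s] := @IVT R (saddle logdigit (ln b%:R)) 0 t 0 (ltW t0).
- exact/continuous_subspaceT/continuous_saddle.
- by rewrite ge_min le_max (ltW g0) (ltW gt) orbT.
rewrite in_itv /= => /andP[s0 _] gs.
have s_gt0 : 0 < s.
  rewrite lt_neqAle s0 andbT; apply/eqP => E; move: gs.
  by rewrite -E => gs; move: g0; rewrite gs ltxx.
exists s; split=> [|r [r0]]; first by split=> //; apply/saddle_eqE.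
rewrite saddle_eqE // => gr.
have mono := @saddle_lt _ _ logdigit (ln b%:R) _ _ _ _ logdigit_neq.
have [s1 r1] : -1 < s /\ -1 < r by split; lra.
by case: (ltgtP s r) => // [/(mono _ _ s1)|/(mono _ _ r1)]; rewrite gs gr ltxx.
Qed.

(** Up to the factor [ln b], this is the exponent produced by the geometric mean of the two counting
    bounds. *)
Lemma eta0E s : 0 <= s -> eta0 b s =
  (s * ln b%:R + lexpsum logdigit s) / ((1 + s) * ln b%:R).
Proof.
move=> s0; have lb : 0 < ln b%:R :> R by rewrite ln_gt0 // ltr1n; lia.
rewrite /eta0 -expsum_logdigit // ln_div ?posrE ?ltr0n ?expsum_gt0 //.
by rewrite -/(lexpsum _ _); field; rewrite ?gt_eqF //; lra.
Qed.

(** Since [lexpsum] lies strictly between 0 and [ln b], the numerator in [eta0E] lies strictly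
    between 0 and the denominator. *)
Lemma eta0_bounds (s : R) : 0 < s -> 0 < eta0 b s < 1.
Proof.
move=> s0; have lb : 0 < ln b%:R :> R by rewrite ln_gt0 // ltr1n; lia.
have L0 : 0 < lexpsum logdigit s.
  by rewrite ln_gt0 //; have := expsum_logdigit_gt2 s; lra.
have Lb : lexpsum logdigit s < ln b%:R.
  by rewrite ltr_ln ?posrE ?ltr0n ?expsum_gt0 //; exact: expsum_logdigit_ltb.
have D : 0 < (1 + s) * ln b%:R by rewrite mulr_gt0 //; lra.
rewrite eta0E ?ltW // divr_gt0 //=; last by nra.
by rewrite ltr_pdivrMr // mul1r; nra.
Qed.

End DigitWeights.

(** * Counting integers below [b ^ N] by their digit vectors *)

Section DigitVectors.
Context {b N : nat} (b0 : (0 < b)%N).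

(** Padding with leading zeros to length [N] turns the digits into independent coordinates. *)
Definition digit_vector (k : 'I_(b ^ N)) : {ffun 'I_N -> 'I_b} :=
  [ffun j : 'I_N => Ordinal (ltn_pmod (k %/ b ^ j) b0)].

Definition vector_prod (f : {ffun 'I_N -> 'I_b}) : nat :=
  (\prod_j maxn 1 (f j))%N.

(** A count is at most [N], so [inord] loses nothing; the finite codomain bounds the number of
    classes. *)
Definition digit_count (f : {ffun 'I_N -> 'I_b}) : {ffun 'I_b -> 'I_N.+1} :=
  [ffun d => inord #|[pred j | f j == d]|].

Lemma digit_vector_inj : injective digit_vector.
Proof.
move=> k l /ffunP E; apply: val_inj => /=.
rewrite -(modn_small (ltn_ord k)) -(modn_small (ltn_ord l)) -!digits_sum //.
by apply: eq_bigr => j _; have := E j; rewrite !ffunE => /(congr1 val) /= ->.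
Qed.

Lemma vector_prod_gt0 f : (0 < vector_prod f)%N.
Proof. by apply: prodn_gt0 => j; rewrite leq_max. Qed.

(** Grouping equal digits expresses the product through the counts alone. *)
Lemma vector_prod_count f g : digit_count f = digit_count g ->
  vector_prod f = vector_prod g.
Proof.
have E h : vector_prod h = (\prod_(d < b) maxn 1 d ^ digit_count h d)%N.
  rewrite /vector_prod (partition_big h predT) //=; apply: eq_bigr => d _.
  rewrite (eq_bigr (fun _ => maxn 1 d)) => [|j /eqP -> //].
  rewrite prod_nat_const ffunE inordK // ltnS -[leqRHS]card_ord.
  exact: max_card.
by rewrite !E => ->.
Qed.

Lemma nzdigit_prod_vector (k : 'I_(b ^ N)) : (1 < b)%N -> (0 < k)%N ->
  nzdigit_prod b k = vector_prod (digit_vector k).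
Proof.
move=> b1 k0; have /andP[lo hi] := trunc_log_bounds b1 k0.
have LN : ((trunc_log b k).+1 <= N)%N.
  by rewrite -(ltn_exp2l _ _ b1) (leq_ltn_trans lo).
rewrite /nzdigit_prod /digits big_map big_mkcond.
rewrite (eq_bigr (fun j => maxn 1 (k %/ b ^ j %% b))); last first.
  by move=> j _; case: (k %/ b ^ j %% b)%N => [|d] //; rewrite (maxn_idPr _).
rewrite -[X in iota 0 X]subn0 /vector_prod.
rewrite (eq_bigr (fun j : 'I_N => maxn 1 (k %/ b ^ j %% b))); last first.
  by move=> j _; rewrite ffunE.
rewrite -(big_mkord predT (fun j => maxn 1 (k %/ b ^ j %% b))).
(* Positions above the leading digit hold zeros, which contribute factors 1. *)
rewrite [RHS](@big_cat_nat _ _ _ (trunc_log b k).+1) //=.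
rewrite [X in (_ * X)%N]big_nat_cond [X in (_ * X)%N]big1 ?muln1 //.
move=> j /andP[/andP[lj _] _]; rewrite divn_small ?mod0n //.
by apply: leq_trans hi _; rewrite leq_exp2l.
Qed.

(** Sending [k] to [k %/ m - 1] injects [K] into the naturals below [M %/ m]. *)
Lemma card_multiples_le (M m : nat) (K : {set 'I_M}) : (0 < m)%N ->
  (forall k, k \in K -> (0 < k)%N && (m %| k)%N) -> (#|K| * m <= M)%N.
Proof.
move=> m0 Km; rewrite -leq_divRL //.
have lt (k : 'I_M) : k \in K -> ((k %/ m).-1 < M %/ m)%N.
  move=> /Km /andP[k0 /dvdnP[q E]]; rewrite E mulnK //.
  have q0 : (0 < q)%N by move: k0; rewrite E muln_gt0 => /andP[].
  by rewrite prednK // leq_divRL // -E ltnW.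
case: (M %/ m)%N lt => [|r] lt.
  by rewrite leqn0 cards_eq0; apply/eqP/setP => k; rewrite inE;
    apply/negP => /lt.
rewrite -[leqRHS]card_ord.
apply: (@leq_card_in _ _ (fun k : 'I_M => inord (k %/ m).-1)).
move=> k l kK lK /(congr1 val) /=; rewrite !inordK ?lt // => E; apply: val_inj.
have /andP[k0 mk] := Km _ kK; have /andP[l0 ml] := Km _ lK.
rewrite /= -(divnK mk) -(divnK ml); congr (_ * _)%N.
by rewrite -(prednK (n := k %/ m)) -1?(prednK (n := l %/ m)) ?E //
  divn_gt0 // dvdn_leq.
Qed.

Context {R : realType}.

Lemma vector_weight (f : {ffun 'I_N -> 'I_b}) (s : R) :
  \prod_j expR (- (logdigit (f j) * s)) = expR (- (ln (vector_prod f)%:R * s)).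
Proof.
rewrite -expR_sum; congr expR.
have -> : (vector_prod f)%:R = expR (\sum_j logdigit (f j)) :> R.
  rewrite expR_sum /vector_prod natr_prod; apply: eq_bigr => j _.
  by rewrite lnK // posrE ltr0n leq_max.
by rewrite expRK mulr_suml sumrN.
Qed.

(* Rankin's trick. *)
Lemma card_vector_prod_le (m : nat) (K : {set 'I_(b ^ N)}) (s : R) :
  (forall k, k \in K -> vector_prod (digit_vector k) = m) ->
  #|K|%:R * expR (- (ln m%:R * s)) <= expsum (@logdigit R b) s ^+ N.
Proof.
move=> Km.
have -> : expsum (@logdigit R b) s ^+ N =
    \prod_(j < N) \sum_(d < b) expR (- (logdigit d * s)).
  by rewrite prodr_const card_ord.
(* Expanding the power gives one positive term per vector; only those coming from [K] are kept. *)
rewrite bigA_distr_bigA mulr_natl -sumr_const /=.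
rewrite (eq_bigr _ (fun f _ => vector_weight f s)).
rewrite [leRHS](bigID (mem (digit_vector @: K))) /=.
apply: ler_wpDr; first by apply: sumr_ge0 => *; exact: expR_ge0.
rewrite big_imset /=; last by move=> ? ? _ _; exact: digit_vector_inj.
by apply: ler_sum => k kK; rewrite Km.
Qed.

Definition divisible_set : {set 'I_(b ^ N)} :=
  [set k : 'I_(b ^ N) | (0 < k)%N && (vector_prod (digit_vector k) %| k)%N].

(* The weighted geometric mean, with weights [s / (1 + s)] and
   [1 / (1 + s)], of the bounds [b ^ N / m] and [m `^ s * expsum ^+ N]
   does not depend on the common digit product [m]. *)
Lemma card_count_class_le (c : {ffun 'I_b -> 'I_N.+1}) (s : R) : 0 <= s ->
  #|[set k in divisible_set | digit_count (digit_vector k) == c]|%:R <=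
  expR (N%:R * ((s * ln b%:R + lexpsum (@logdigit R b) s) / (1 + s))).
Proof.
move=> s0; set K := [set k in _ | _].
have [->|[k0 k0K]] := set_0Vmem K; first by rewrite cards0 expR_ge0.
pose m := vector_prod (digit_vector k0).
have m0 : (0 < m)%N := vector_prod_gt0 _.
have Km k : k \in K -> vector_prod (digit_vector k) = m.
  move: k0K; rewrite !inE => /andP[_ /eqP E0] /andP[_ /eqP E].
  by apply: vector_prod_count; rewrite E E0.
have K0 : (0 < #|K|)%N by apply/card_gt0P; exists k0.
have Z0 : 0 < expsum (@logdigit R b) s by rewrite expsum_gt0.
have h1 : (#|K| * m <= b ^ N)%N.
  apply: card_multiples_le => // k kK; rewrite -(Km _ kK).
  by move: kK; rewrite !inE => /andP[].
have {}h1 : ln #|K|%:R + ln m%:R <= ln b%:R * N%:R :> R.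
  rewrite -lnM ?posrE ?ltr0n // [leRHS]mulr_natr -lnXn ?ltr0n // -natrX -natrM.
  by rewrite ler_ln ?posrE ?ltr0n ?muln_gt0 ?K0 ?expn_gt0 ?b0 // ler_nat.
have h2 : ln #|K|%:R - ln m%:R * s <= lexpsum (@logdigit R b) s * N%:R :> R.
  rewrite [leRHS]mulr_natr -lnXn // -[X in _ + X <= _](expRK (- _)).
  rewrite -lnM ?posrE ?ltr0n ?expR_gt0 // ler_ln ?posrE ?exprn_gt0 //.
    exact: card_vector_prod_le.
  by rewrite mulr_gt0 ?ltr0n ?expR_gt0.
rewrite -[leLHS]lnK ?posrE ?ltr0n // ler_expR mulrA ler_pdivlMr; last by lra.
(* Adding [s] times [h1] to [h2] cancels [ln m]. *)
by nra.
Qed.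

Lemma card_divisible_set_le (s : R) : 0 <= s -> #|divisible_set|%:R <=
  N.+1%:R ^+ b *
  expR (N%:R * ((s * ln b%:R + lexpsum (@logdigit R b) s) / (1 + s))).
Proof.
move=> s0; rewrite -sum1_card natr_sum.
rewrite (partition_big (fun k => digit_count (digit_vector k)) predT) //=.
apply: (@le_trans _ _ (\sum_(c : {ffun 'I_b -> 'I_N.+1})
  expR (N%:R * ((s * ln b%:R + lexpsum (@logdigit R b) s) / (1 + s))))).
  apply: ler_sum => c _; apply: le_trans (card_count_class_le c s s0).
  by rewrite -natr_sum sum1dep_card.
by rewrite sumr_const card_ffun !card_ord -[leLHS]mulr_natl natrX.
Qed.

End DigitVectors.

(** * From powers of [b] to real [x], and the error term *)

Section CountingBound.
Context {R : realType} {b : nat} (b3 : (3 <= b)%N).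
Let b0 : (0 < b)%N := leq_trans (isT : 0 < 3)%N b3.
Let b1 : (1 < b)%N := leq_trans (isT : 1 < 3)%N b3.

Lemma card_Nb0_le (x : R) (N : nat) : (Num.truncn x < b ^ N)%N ->
  (card_Nb0 b x <= #|divisible_set (N := N) b0|)%N.
Proof.
move=> xN; have -> : #|divisible_set (N := N) b0| =
    size [seq val k | k <- enum (divisible_set (N := N) b0)].
  by rewrite size_map -cardE.
apply: uniq_leq_size => [|k]; first exact: fset_uniq.
have -> : (k \in enum_fset (fset_set (Nb0 b x))) = (k \in fset_set (Nb0 b x)).
  by [].
rewrite in_fset_set ?inE; last exact: finite_Nb0.
case=> k0 kx kp; have kN : (k < b ^ N)%N.
  by apply: leq_ltn_trans xN; rewrite -[k](natrK (R := R)); exact: le_truncn.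
apply/mapP; exists (Ordinal kN) => //.
by rewrite mem_enum inE k0 -nzdigit_prod_vector.
Qed.

(** Used to absorb powers of [ln x] into the error term; it is the square of [y <= expR y] at
    [y = Num.sqrt v]. *)
Lemma le_expR_sqrt (v : R) : 0 <= v -> v <= expR (2 * Num.sqrt v).
Proof.
move=> v0; rewrite -{1}(sqr_sqrtr v0) mulrDl mul1r expRD -expr2.
have le : Num.sqrt v <= expR (Num.sqrt v).
  by apply: le_trans (expR_ge1Dx _); rewrite lerDr.
by rewrite lerXn2r ?nnegrE ?sqrtr_ge0 ?expR_ge0.
Qed.

Lemma card_Nb0_lt (s : R) : 0 < s -> exists K : R,
  forall x, expR 1 <= x ->
    (card_Nb0 b x)%:R < expR (eta0 b s * ln x + K * Num.sqrt (ln x)).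
Proof.
move=> s0; have /andP[e0 e1] := eta0_bounds b3 s s0.
have lb : 0 < ln b%:R :> R by rewrite ln_gt0 // ltr1n.
(* Chosen so that [l.+2 <= C * u], from [l <= u / ln b] and [2 <= 2 * u]. *)
pose C : R := (ln b%:R)^-1 + 2.
have C0 : 0 <= C by rewrite addr_ge0 // invr_ge0 ltW.
(* The summands pay for rounding [x] up to a power of [b], for the number of classes and for
   strictness. *)
exists (eta0 b s * ln b%:R + b%:R * (2 * Num.sqrt C) + 1) => x xe.
have x0 : 0 < x := lt_le_trans (expR_gt0 1) xe.
pose u := ln x; have u1 : 1 <= u by rewrite -[1]expRK ler_ln ?posrE ?expR_gt0.
have x1 : 1 <= x.
  by apply: le_trans xe; rewrite (le_trans _ (expR_ge1Dx _)) ?lerDl.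
have t0 : (0 < Num.truncn x)%N by rewrite truncn_gt0.
pose l := trunc_log b (Num.truncn x).
have /andP[lo hi] := trunc_log_bounds b1 t0.
have lu : l%:R * ln b%:R <= u.
  rewrite mulr_natl -lnXn ?ltr0n // ler_ln ?posrE ?exprn_gt0 ?ltr0n //.
  by rewrite -natrX -truncn_ge_nat ?ltW.
have := card_divisible_set_le b0 s (ltW s0) (N := l.+1).
set E := expR _ => le_card.
have EE : E <= expR (eta0 b s * u + eta0 b s * ln b%:R).
  rewrite ler_expR.
  have -> : (s * ln b%:R + lexpsum (@logdigit R b) s) / (1 + s)
      = eta0 b s * ln b%:R.
    rewrite eta0E ?ltW //; field; rewrite ?gt_eqF //; lra.
  by rewrite -natr1; nra.
have PP : l.+2%:R ^+ b <= expR (b%:R * (2 * Num.sqrt C) * Num.sqrt u) :> R.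
  have -> : b%:R * (2 * Num.sqrt C) * Num.sqrt u =
      b%:R * (2 * Num.sqrt (C * u)) by rewrite sqrtrM // !mulrA.
  rewrite expRM_natl lerXn2r ?nnegrE ?expR_ge0 //.
  apply: (@le_trans _ _ (C * u)); last first.
    by apply: le_expR_sqrt; rewrite mulr_ge0 //; lra.
  have : l%:R <= (ln b%:R)^-1 * u by rewrite mulrC ler_pdivlMr.
  by rewrite /C -!natr1 mulrDl; lra.
apply: (@le_lt_trans _ _ (l.+2%:R ^+ b * E)).
  by apply: le_trans le_card; rewrite ler_nat card_Nb0_le.
apply: (@le_lt_trans _ _ (expR (b%:R * (2 * Num.sqrt C) * Num.sqrt u) *
    expR (eta0 b s * u + eta0 b s * ln b%:R))).
  by apply: ler_pM => //; exact: expR_ge0.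
rewrite -expRD ltr_expR.
have su1 : 1 <= Num.sqrt u by rewrite -[leLHS]sqrtr1 ler_wsqrtr.
have A0 : 0 <= eta0 b s * ln b%:R by rewrite mulr_ge0 ?ltW.
by rewrite -/u; move: (eta0 b s) A0 => e A0; nra.
Qed.

Lemma Nb0_lt_powR_o1 (s : R) : 0 < s ->
  lt_powR_o1 (fun x : R => (card_Nb0 b x)%:R) (eta0 b s).
Proof.
move=> s0; have [K HK] := card_Nb0_lt s s0.
(* Multiplied by [ln x], this becomes the error [K * Num.sqrt (ln x)] of [card_Nb0_lt]. *)
exists (fun x => K / Num.sqrt (ln x)); split.
  rewrite -[X in _ --> X](mulr0 K); apply: cvgM; first exact: cvg_cst.
  apply/cvgr0Pnorm_lt => e e0.
  near=> x.
  have lx : (e^-1) ^+ 2 < ln x.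
    rewrite -ltr_expR lnK ?posrE.
      by near: x; apply: nbhs_pinfty_gt; rewrite num_real.
    by near: x; apply: nbhs_pinfty_gt; rewrite num_real.
  have h : e^-1 < Num.sqrt (ln x).
    rewrite -[ltLHS]ger0_norm ?invr_ge0 ?ltW // -sqrtr_sqr ltr_sqrt //.
    by rewrite (le_lt_trans _ lx) ?exprn_ge0 // invr_ge0 ltW.
  rewrite ger0_norm ?invr_ge0 ?sqrtr_ge0 //.
  by rewrite invf_plt // posrE (lt_trans _ h) // invr_gt0.
near=> x.
have xe : expR 1 <= x by near: x; apply: nbhs_pinfty_ge; rewrite num_real.
have x0 : 0 < x := lt_le_trans (expR_gt0 1) xe.
have u1 : 1 <= ln x by rewrite -[1]expRK ler_ln ?posrE ?expR_gt0.
rewrite /powR gt_eqF //; apply: lt_le_trans (HK x xe) _.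
rewrite ler_expR (mulrDl (eta0 b s)) lerD2l.
have q0 : 0 < Num.sqrt (ln x) by rewrite sqrtr_gt0; lra.
rewrite -[X in _ <= _ * X]sqr_sqrtr; last by lra.
by rewrite expr2 mulrA divfK // gt_eqF.
Unshelve. all: by end_near. Qed.

End CountingBound.

Theorem theorem2p1 (R : realType) (b : nat) (hb : (3 <= b)%N) :
  (exists! s : R, 0 < s /\ saddle_eq b s) /\
  (forall s : R, 0 < s -> saddle_eq b s ->
     0 < eta0 b s < 1 /\
     lt_powR_o1 (fun x : R => (card_Nb0 b x)%:R) (eta0 b s)).
Proof.
split; first exact: exists_unique_saddle.
by move=> s s0 _; split; [exact: eta0_bounds|exact: Nb0_lt_powR_o1].
Qed.
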